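(* Assume the Slater condition holds for (LSIP), and that for some Slater point $\bar{x}$ the level set $L(\bar{x}) = \{x\in F \mid c^{\top}x\leq c^{\top}\bar{x}\}$ is bounded. Let $\{T_k\}_{k\ge 0}$ be a sequence of subdivisions of $Y$ obtained recursively by trisection refinement, such that $T_0$ is consistent (i.e. $\bar{F}(T_0)\ne\emptyset$) and $\lim_{k\to\infty}|T_k|=0$. For each $k$ let $x_k^*$ be an optimal solution of R2-LSIP($T_k$), and write $f(x)=c^{\top}x$. Then: (1) each $x_k^*$ is feasible for (LSIP), and any accumulation point of the sequence $\{x_k^*\}$ is a feasible solution of (LSIP); (2) $\{f(x_k^* )\}$ is a decreasing sequence (i.e. $f(x_{k+1}^* )\le f(x_k^* )$ for all $k$), and $v^*=\lim_{k\to\infty}f(x_k^* )$ is the optimal value of (LSIP).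
   Context: Problem (LSIP): let $Y=[a,b]\subset\mathbb{R}$ with $a<b$, $c\in\mathbb{R}^n$, and coefficient functions $a_i:\mathbb{R}\to\mathbb{R}$, $i=0,1,\dots,n$, which are twice continuously differentiable on $Y$; put $a(y)=[a_1(y),\dots,a_n(y)]^{\top}$ and $\mathbb{R}^n_+=\{x\in\mathbb{R}^n\mid x_i\ge 0,\ i=1,\dots,n\}$. (LSIP) is: minimize $c^{\top}x$ over the feasible set $F=\{x\in\mathbb{R}^n_+\mid a(y)^{\top}x+a_0(y)\ge 0\ \ \forall y\in Y\}$. Slater condition: there exists $\bar{x}\in\mathbb{R}^n_+$ with $a(y)^{\top}\bar{x}+a_0(y)>0$ for all $y\in Y$; such an $\bar{x}$ is called a Slater point. Subdivision: $T=\{\tau_0,\dots,\tau_N\}$ with $a=\tau_0\le\tau_1\le\dots\le\tau_N=b$; $Y_k=[\tau_{k-1},\tau_k]$, $|Y_k|=|\tau_k-\tau_{k-1}|$, $|T|=\max_{1\le k\le N}|Y_k|$. Approximate problem: each subinterval $Y_k$ of $T$ carries parameters $\alpha_{i,k}\ge\max\{0,\max_{y\in Y_k}a_i''(y)\}$, $i=0,\dots,n$, and on $Y_k$ one defines $\bar{a}_i(y)=a_i(y)-\frac{\alpha_{i,k}}{2}\left(y-\frac{\tau_{k-1}+\tau_k}{2}\right)^2$. R2-LSIP($T$) is: minimize $c^{\top}x$ over $$\bar{F}(T)=\Big\{x\in\mathbb{R}^n_+\ \Big|\ \sum_{i=1}^n\min\{\bar{a}_i(\tau_{k-1}),\bar{a}_i(\tau_k)\}x_i+\min\{\bar{a}_0(\tau_{k-1}),\bar{a}_0(\tau_k)\}\ge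 0,\ k=1,\dots,N\Big\},$$ where in the $k$-th constraint $\bar{a}_i$ is the function defined on $Y_k$. $T$ is called consistent if $\bar{F}(T)\ne\emptyset$. Trisection refinement: a subinterval $Y_k=[\tau_{k-1},\tau_k]$ of $T$ is refined by inserting $\tau_{k,1}=\tau_{k-1}+\frac13(\tau_k-\tau_{k-1})$ and $\tau_{k,2}=\tau_{k-1}+\frac23(\tau_k-\tau_{k-1})$, giving $Y_{k,1}=[\tau_{k-1},\tau_{k,1}]$, $Y_{k,2}=[\tau_{k,1},\tau_{k,2}]$, $Y_{k,3}=[\tau_{k,2},\tau_k]$. The new subintervals carry parameters $\alpha_{i,k}^j$ ($j=1,2,3$, $i=0,\dots,n$) with $\max\{0,\max_{y\in Y_{k,j}}a_i''(y)\}\le\alpha_{i,k}^j\le\alpha_{i,k}$; the constraint for $Y_k$ is replaced by the three constraints of the same form for $Y_{k,1},Y_{k,2},Y_{k,3}$ (with the midpoint and parameter of the respective new subinterval). Parameters and constraints of subintervals that are not refined are unchanged. ''Obtained recursively by trisection refinement'' means that each $T_{k+1}$ arises from $T_k$ by trisecting one or more of its subintervals in this way. *)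

(* Defs.v *)
From HB Require Import structures.
From mathcomp Require Import all_boot all_order all_algebra.
From mathcomp Require Import all_classical all_reals all_analysis.

Set Implicit Arguments.
Unset Strict Implicit.
Unset Printing Implicit Defensive.

Import Order.TTheory GRing.Theory Num.Theory.
Import numFieldNormedType.Exports.

Local Open Scope classical_set_scope.
Local Open Scope ring_scope.

(* Derivatives relative to a set [A], so that they are one-sided at the
   endpoints when [A] is a closed interval. *)

Definition derivable_in (R : realType) (A : set R) (f : R -> R) : Prop :=
  forall x, A x -> cvg ((f y - f x) / (y - x) @[y --> within A x^']).

Definition deriv_in (R : realType) (A : set R) (f : R -> R) (x : R) : R :=
  lim ((f y - f x) / (y - x) @[y --> within A x^']).

Definition deriv2_in (R : realType) (A : set R) (f : R -> R) : R -> R :=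
  deriv_in A (deriv_in A f).

Definition C2_on (R : realType) (A : set R) (f : R -> R) : Prop :=
  [/\ derivable_in A f,
      derivable_in A (deriv_in A f) &
      {within A, continuous (deriv2_in A f)}].

(* The family [coef : 'I_n.+1 -> R -> R] collects all the coefficient functions:
   [coef ord0] is a_0, and [coef (lift ord0 i)] is the coefficient function
   that multiplies the coordinate [x i 0]. *)

Definition avec (R : realType) (n : nat) (coef : 'I_n.+1 -> R -> R) (y : R)
  : 'cV[R]_n := \col_i coef (lift ord0 i) y.

Definition dot (R : realType) (n : nat) (u v : 'cV[R]_n) : R :=
  (u^T *m v) 0 0.

Definition nonneg_orthant (R : realType) (n : nat) : set 'cV[R]_n :=
  [set x | forall i, 0 <= x i 0].

Definition feasible (R : realType) (n : nat) (a b : R)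
    (coef : 'I_n.+1 -> R -> R) : set 'cV[R]_n :=
  [set x | nonneg_orthant x /\
     forall y, y \in `[a, b] -> 0 <= dot (avec coef y) x + coef ord0 y].

Definition slater_point (R : realType) (n : nat) (a b : R)
    (coef : 'I_n.+1 -> R -> R) : set 'cV[R]_n :=
  [set x | nonneg_orthant x /\
     forall y, y \in `[a, b] -> 0 < dot (avec coef y) x + coef ord0 y].

Definition slater_condition (R : realType) (n : nat) (a b : R)
    (coef : 'I_n.+1 -> R -> R) : Prop :=
  slater_point a b coef !=set0.

Definition level_set (R : realType) (n : nat) (a b : R)
    (coef : 'I_n.+1 -> R -> R) (c xbar : 'cV[R]_n) : set 'cV[R]_n :=
  [set x | feasible a b coef x /\ dot c x <= dot c xbar].

Definition optimal_value (R : realType) (n : nat) (a b : R)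
    (coef : 'I_n.+1 -> R -> R) (c : 'cV[R]_n) : \bar R :=
  ereal_inf [set (dot c x)%:E | x in feasible a b coef].

Definition optimal_solution (R : realType) (n : nat) (c : 'cV[R]_n)
    (S : set 'cV[R]_n) : set 'cV[R]_n :=
  [set x | S x /\ forall z, S z -> dot c x <= dot c z].

(* A subinterval together with its parameters: (left endpoint, right endpoint,
   alpha).  A subdivision is the list of its subintervals, from left to right. *)
Definition cell (R : realType) (n : nat) : Type :=
  (R * R * {ffun 'I_n.+1 -> R})%type.

Definition lend (R : realType) (n : nat) (K : cell R n) : R := K.1.1.
Definition rend (R : realType) (n : nat) (K : cell R n) : R := K.1.2.
Definition alpha (R : realType) (n : nat) (K : cell R n) (i : 'I_n.+1) : R :=
  K.2 i.

Fixpoint is_subdivision (R : realType) (n : nat) (a b : R) (T : seq (cell R n))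
  : Prop :=
  if T is K :: T' then
    [/\ lend K = a, lend K <= rend K & is_subdivision (rend K) b T']
  else a = b.

Definition mesh (R : realType) (n : nat) (T : seq (cell R n)) : R :=
  \big[Num.max/0]_(K <- T) `|rend K - lend K|.

(* The [sup] is a maximum: under [C2_on] the second derivative is continuous on
   the compact interval. *)
Definition admissible_cell (R : realType) (n : nat) (a b : R)
    (coef : 'I_n.+1 -> R -> R) (K : cell R n) : Prop :=
  forall i, Num.max 0
    (sup [set deriv2_in `[a, b] (coef i) y | y in `[lend K, rend K]])
      <= alpha K i.

Definition admissible (R : realType) (n : nat) (a b : R)
    (coef : 'I_n.+1 -> R -> R) (T : seq (cell R n)) : Prop :=
  forall K : cell R n, K \in T -> admissible_cell a b coef K.

Definition abar (R : realType) (n : nat) (coef : 'I_n.+1 -> R -> R)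
    (K : cell R n) (i : 'I_n.+1) (y : R) : R :=
  coef i y - alpha K i / 2 * (y - (lend K + rend K) / 2) ^+ 2.

Definition abar_min (R : realType) (n : nat) (coef : 'I_n.+1 -> R -> R)
    (K : cell R n) (i : 'I_n.+1) : R :=
  Num.min (abar coef K i (lend K)) (abar coef K i (rend K)).

Definition feasible_R2 (R : realType) (n : nat) (coef : 'I_n.+1 -> R -> R)
    (T : seq (cell R n)) : set 'cV[R]_n :=
  [set x | nonneg_orthant x /\ forall K : cell R n, K \in T ->
     0 <= \sum_(i < n) abar_min coef K (lift ord0 i) * x i 0
          + abar_min coef K ord0].

Definition consistent (R : realType) (n : nat) (coef : 'I_n.+1 -> R -> R)
    (T : seq (cell R n)) : Prop :=
  feasible_R2 coef T !=set0.

Definition child_of (R : realType) (n : nat) (a b : R)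
    (coef : 'I_n.+1 -> R -> R) (K : cell R n) (s t : R) (K' : cell R n)
  : Prop :=
  [/\ lend K' = s, rend K' = t, admissible_cell a b coef K' &
      forall i, alpha K' i <= alpha K i].

Definition trisects (R : realType) (n : nat) (a b : R)
    (coef : 'I_n.+1 -> R -> R) (K K1 K2 K3 : cell R n) : Prop :=
  let s := lend K in
  let t := rend K in
  let p := s + 1 / 3 * (t - s) in
  let q := s + 2 / 3 * (t - s) in
  [/\ child_of a b coef K s p K1,
      child_of a b coef K p q K2 &
      child_of a b coef K q t K3].

Inductive refines (R : realType) (n : nat) (a b : R)
    (coef : 'I_n.+1 -> R -> R) : seq (cell R n) -> seq (cell R n) -> Prop :=
| refines_nil : refines a b coef [::] [::]
| refines_keep K T T' :
    refines a b coef T T' -> refines a b coef (K :: T) (K :: T')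
| refines_trisect K K1 K2 K3 T T' :
    trisects a b coef K K1 K2 K3 -> refines a b coef T T' ->
    refines a b coef (K :: T) [:: K1, K2, K3 & T'].

(* The size grows iff at least one subinterval is trisected. *)
Definition trisection_refinement (R : realType) (n : nat) (a b : R)
    (coef : 'I_n.+1 -> R -> R) (T T' : seq (cell R n)) : Prop :=
  refines a b coef T T' /\ (size T < size T')%N.

(* Main.v *)
(** On each subinterval [abar] is concave and lies below the coefficient, so the
    smaller of its two end values bounds the coefficient from below: the
    approximate feasible sets lie inside [F].  Passing to a trisection raises
    these lower bounds, so the approximate sets grow and the values decrease.
    Finally the lower bounds are within [O(|T|)] of the coefficients, uniformly
    in [k] because the parameters never increase, so every Slater point is
    eventually feasible for the approximate problem; any feasible point is a
    limit of Slater points along the segment towards [xbar]. *)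

Require Import Defs.
From HB Require Import structures.
From mathcomp Require Import all_boot all_order all_algebra.
From mathcomp Require Import all_classical all_reals all_analysis.
From mathcomp Require Import lra ring.

Set Implicit Arguments.
Unset Strict Implicit.
Unset Printing Implicit Defensive.

Import Order.TTheory GRing.Theory Num.Theory.
Import numFieldNormedType.Exports.

Local Open Scope classical_set_scope.
Local Open Scope ring_scope.

(** * Calculus with derivatives relative to an interval *)

Lemma deriv_in_dist (R : realType) (A : set R) (f : R -> R) (x e : R) :
  derivable_in A f -> A x -> 0 < e ->
  exists2 d, 0 < d & forall y, A y -> y != x -> `|x - y| < d ->
    `|deriv_in A f x - (f y - f x) / (y - x)| <= e.
Proof.
move=> df Ax e0; have /cvgrPdist_le /(_ e e0) := df x Ax.
rewrite near_withinE near_withinE => /nbhs_ballP[d /= d0 Hd].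
by exists d => // y Ay yx xy; apply: Hd.
Qed.

(** At an interior point small increments stay in the interval, so the relative limit is the
    ordinary derivative; this gives access to the mean value theorem. *)
Lemma is_derive_deriv_in (R : realType) (a b : R) (f : R -> R) (x : R) :
  derivable_in `[a, b] f -> x \in `]a, b[ ->
  is_derive x 1 f (deriv_in `[a, b] f x).
Proof.
move=> df xab; have := xab; rewrite in_itv /= => /andP[ax xb].
have Ax : `[a, b]%classic x by rewrite /= in_itv /= (ltW ax) (ltW xb).
have H : h^-1 *: ((f \o shift x) (h *: 1) - f x) @[h --> 0^']
    --> deriv_in `[a, b] f x.
  apply/cvgrPdist_le => e e0; have [d d0 Hd] := deriv_in_dist df Ax e0.
  have m0 : 0 < Num.min d (Num.min (x - a) (b - x)).
    by rewrite !lt_min d0 !subr_gt0 ax xb.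
  rewrite near_withinE; apply/nbhs_ballP.
  exists (Num.min d (Num.min (x - a) (b - x))) => //= h.
  rewrite /ball /= sub0r normrN !lt_min => /and3P[hd ha hb] h0.
  have -> : h^-1 *: (f (h *: 1 + x) - f x) = (f (h + x) - f x) / (h + x - x).
    by rewrite addrK /GRing.scale /= mulr1 mulrC.
  apply: Hd.
  - rewrite /= in_itv /=; move: ha hb; rewrite !ltr_norml => /andP[? ?] /andP[? ?].
    by apply/andP; split; lra.
  - by rewrite -subr_eq0 addrK.
  - by rewrite opprD addrC addrNK normrN.
by apply: DeriveDef; [apply/cvg_ex; exists (deriv_in `[a, b] f x) | apply: cvg_lim H].
Qed.

(** Near [x] the difference quotient is bounded by [L], the absolute value of the derivative plus
    one, so increments of [f] are at most [L] times the displacement. *)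
Lemma derivable_in_continuous (R : realType) (A : set R) (f : R -> R) :
  derivable_in A f -> {within A, continuous f}.
Proof.
move=> df; apply/subspace_continuousP => x Ax; apply/cvgrPdist_le => e e0.
have [d d0 Hd] := deriv_in_dist df Ax ltr01.
set L := `|deriv_in A f x| + 1.
have L0 : 0 < L by rewrite /L ltr_wpDl.
have m0 : 0 < Num.min d (e / L) by rewrite lt_min d0 divr_gt0.
rewrite near_withinE; apply/nbhs_ballP; exists (Num.min d (e / L)) => //= y.
rewrite /ball /= lt_min => /andP[yd ye] Ay.
have [->|yx] := eqVneq y x; first by rewrite subrr normr0 ltW.
have {}Hd := Hd y Ay yx yd.
have yx0 : y - x != 0 by rewrite subr_eq0.
have -> : f x - f y = (f y - f x) / (y - x) * (x - y) by field.
rewrite normrM; apply: (@le_trans _ _ (L * (e / L))); last by rewrite mulrC divfK ?gt_eqF.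
apply: ler_pM => //; last exact: ltW.
rewrite /L -lerBlDl (le_trans _ Hd) // distrC.
exact: lerB_dist.
Qed.

Lemma C2_on_continuous (R : realType) (A : set R) (f : R -> R) :
  C2_on A f -> {within A, continuous f}.
Proof. by case=> df _ _; apply: derivable_in_continuous. Qed.

(** The first derivative is continuous on a compact interval, hence bounded, and the mean value
    theorem applies. *)
Lemma C2_on_lipschitz (R : realType) (a b : R) (f : R -> R) :
  a <= b -> C2_on `[a, b] f ->
  exists2 L, 0 <= L & forall s t, a <= s -> s <= t -> t <= b ->
    `|f t - f s| <= L * (t - s).
Proof.
move=> ab [df ddf _]; have cdf := derivable_in_continuous ddf.
have [m _ Hm] := EVT_min ab cdf; have [M _ HM] := EVT_max ab cdf.
set g := deriv_in `[a, b] f in Hm HM *.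
(* The extreme values of the derivative may have either sign; the sum of their absolute values
   bounds it on both sides. *)
exists (`|g m| + `|g M|) => [|s t sa st tb]; first by rewrite addr_ge0.
have cst : {within `[s, t], continuous f}.
  apply: continuous_subspaceW (derivable_in_continuous df).
  by apply: subset_itvScc; rewrite bnd_simp.
have dst x : x \in `]s, t[ -> is_derive x 1 f (g x).
  move=> xst; apply: is_derive_deriv_in => //; move: xst.
  by rewrite !in_itv /= => /andP[? ?]; rewrite (le_lt_trans sa) ?(lt_le_trans _ tb).
have [x xst ->] := MVT_segment st dst cst.
rewrite normrM (ger0_norm (x := t - s)) ?subr_ge0 //.
apply: ler_wpM2r; first by rewrite subr_ge0.
have xab : x \in `[a, b].
  by move: xst; rewrite !in_itv /= => /andP[? ?]; rewrite (le_trans sa) ?(le_trans _ tb).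
move: (Hm x xab) (HM x xab) (ler_norm (g M)) (ler_norm (- g m)).
move: (normr_ge0 (g m)) (normr_ge0 (g M)); rewrite normrN ler_norml.
move: (g x) (g m) (g M) `|g m| `|g M| => {cst dst Hm HM cdf df ddf xab xst}.
by move=> *; apply/andP; split; lra.
Qed.

(* A function dipping strictly below both end values has, by the mean value
   theorem applied three times, a point of positive second derivative. *)
Lemma min_le_of_deriv2_le0 (R : realType) (s t : R) (g g1 g2 : R -> R) :
  (forall x, x \in `]s, t[ -> is_derive x 1 g (g1 x)) ->
  (forall x, x \in `]s, t[ -> is_derive x 1 g1 (g2 x)) ->
  (forall x, x \in `]s, t[ -> g2 x <= 0) ->
  {within `[s, t], continuous g} ->
  forall y, y \in `[s, t] -> Num.min (g s) (g t) <= g y.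
Proof.
move=> dg dg1 g2le0 cg y; rewrite in_itv /= => /andP[sy yt].
have [->|sney] := eqVneq y s; first by rewrite ge_min lexx.
have [->|tney] := eqVneq y t; first by rewrite ge_min lexx orbT.
have {sney}sy' : s < y by rewrite lt_neqAle eq_sym sney.
have {tney}yt' : y < t by rewrite lt_neqAle tney.
rewrite leNgt lt_min; apply/negP => /andP[ys ytl].
have sub u v : s <= u -> v <= t -> `[u, v] `<=` `[s, t].
  by move=> su vt; apply: subset_itvScc; rewrite bnd_simp.
have csy := continuous_subspaceW (sub s y (lexx s) yt) cg.
have cyt := continuous_subspaceW (sub y t sy (lexx t)) cg.
have dsy x : x \in `]s, y[ -> is_derive x 1 g (g1 x).
  rewrite in_itv /= => /andP[sx xy]; apply: dg.
  by rewrite in_itv /= sx (lt_le_trans xy).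
have dyt x : x \in `]y, t[ -> is_derive x 1 g (g1 x).
  rewrite in_itv /= => /andP[yx xt]; apply: dg.
  by rewrite in_itv /= xt (le_lt_trans sy).
have [u usy eu] := MVT sy' dsy csy; have [v vyt ev] := MVT yt' dyt cyt.
move: usy vyt; rewrite !in_itv /= => /andP[su uy] /andP[yv vt].
have uv : u < v := lt_trans uy yv.
have g1u : g1 u < 0.
  by rewrite -(pmulr_llt0 _ (_ : 0 < y - s)) -?eu ?subr_lt0 ?subr_gt0.
have g1v : 0 < g1 v.
  by rewrite -(pmulr_lgt0 _ (_ : 0 < t - y)) -?ev ?subr_gt0.
have inst x : u <= x -> x <= v -> x \in `]s, t[.
  by move=> ux xv; rewrite in_itv /= (lt_le_trans su) ?(le_lt_trans xv).
have duv x : x \in `]u, v[ -> is_derive x 1 g1 (g2 x).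
  by rewrite in_itv /= => /andP[ux xv]; apply/dg1/inst; apply: ltW.
have cuv : {within `[u, v], continuous g1}.
  apply: derivable_within_continuous => x; rewrite in_itv /= => /andP[ux xv].
  by have [] := dg1 x (inst x ux xv).
have [w wuv ew] := MVT uv duv cuv.
move: wuv; rewrite in_itv /= => /andP[uw wv].
have := g2le0 w (inst w (ltW uw) (ltW wv)); rewrite leNgt => /negP; apply.
by rewrite -(pmulr_lgt0 _ (_ : 0 < v - u)) -?ew ?subr_gt0 // (lt_trans g1u).
Qed.

(** * Subdivisions: cells, covering and mesh *)

Lemma subdivision_cell (R : realType) (n : nat) (a b : R) (T : seq (cell R n))
    (K : cell R n) :
  is_subdivision a b T -> K \in T ->
  [/\ a <= lend K, lend K <= rend K & rend K <= b].
Proof.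
have le_ab a' T' : is_subdivision a' b T' -> a' <= b.
  elim: T' a' => [a' /= ->|K' T' IH a' /= [<- lr /IH]] //; exact: le_trans.
elim: T a => //= K' T IH a [<- lr sT]; rewrite in_cons => /orP[/eqP ->|KT].
  by split => //; apply: le_ab sT.
by have [? ? ?] := IH _ sT KT; split => //; apply: le_trans lr _.
Qed.

Lemma subdivision_cover (R : realType) (n : nat) (a b : R) (T : seq (cell R n))
    (y : R) :
  is_subdivision a b T -> a < b -> y \in `[a, b] ->
  exists2 K, K \in T & y \in `[lend K, rend K].
Proof.
rewrite in_itv /= => sT ab /andP[].
(* The empty list subdivides only a degenerate interval, excluded by [a < b]; in the inductive step
   [rend K < y <= b] keeps the remaining interval nondegenerate. *)
elim: T a sT ab => [a /= -> |K T IH a /= [<- lr sT] ab ay yb]; first by rewrite ltxx.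
have [yr|ry] := leP y (rend K).
  by exists K; rewrite ?mem_head // in_itv /= ay.
have [K' K'T yK'] := IH _ sT (lt_le_trans ry yb) (ltW ry) yb.
by exists K' => //; rewrite in_cons K'T orbT.
Qed.

Lemma mesh_ge (R : realType) (n : nat) (T : seq (cell R n)) (K : cell R n) :
  K \in T -> rend K - lend K <= mesh T.
Proof.
move=> KT; apply: le_trans (ler_norm _) _.
exact: (@le_bigmax_seq _ _ _ _ 0 K xpredT (fun K => `|rend K - lend K|)).
Qed.

(** * Lower bounds for the coefficients on a cell *)

Section Cells.
Variables (R : realType) (n : nat) (a b : R) (coef : 'I_n.+1 -> R -> R).
Hypotheses (hab : a < b) (hC2 : forall i, C2_on `[a, b] (coef i)).

Lemma admissible_alpha_ge0 (K : cell R n) i :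
  admissible_cell a b coef K -> 0 <= alpha K i.
Proof. by move=> /(_ i); rewrite ge_max => /andP[]. Qed.

(** [sup] is an upper bound only for a set bounded above; the maximum of the continuous second
    derivative on [[a, b]] provides such a bound. *)
Lemma admissible_deriv2_le (K : cell R n) i y :
  a <= lend K -> rend K <= b -> admissible_cell a b coef K ->
  y \in `[lend K, rend K] -> deriv2_in `[a, b] (coef i) y <= alpha K i.
Proof.
move=> al rb /(_ i); rewrite ge_max => /andP[_ supK] yK.
apply: le_trans supK; apply: ub_le_sup; last by exists y.
have [_ _ c2] := hC2 i; have [x _ Hx] := EVT_max (ltW hab) c2.
exists (deriv2_in `[a, b] (coef i) x) => _ [t tK <-]; apply: Hx.
by move: tK; rewrite /= !in_itv /= => /andP[? ?]; rewrite (le_trans al) ?(le_trans _ rb).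
Qed.

Lemma abar_le_coef (K : cell R n) i y :
  admissible_cell a b coef K -> abar coef K i y <= coef i y.
Proof.
move=> /(admissible_alpha_ge0 i) a0.
by rewrite /abar gerBl mulr_ge0 ?divr_ge0 ?sqr_ge0.
Qed.

(** The quadratic term lowers the second derivative by [alpha K i], making it nonpositive on the
    cell. *)
Lemma abar_min_le (K : cell R n) i y :
  a <= lend K -> rend K <= b -> admissible_cell a b coef K ->
  y \in `[lend K, rend K] -> abar_min coef K i <= abar coef K i y.
Proof.
move=> al rb adm; have [df ddf _] := hC2 i.
pose m := (lend K + rend K) / 2.
have sub x : x \in `]lend K, rend K[ -> x \in `]a, b[.
  by rewrite !in_itv /= => /andP[? ?]; rewrite (le_lt_trans al) ?(lt_le_trans _ rb).
apply: (@min_le_of_deriv2_le0 _ _ _ _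
  (fun x => deriv_in `[a, b] (coef i) x - alpha K i * (x - m))
  (fun x => deriv2_in `[a, b] (coef i) x - alpha K i)).
- move=> x /sub xab; have ? := is_derive_deriv_in df xab.
  apply: is_derive_eq; rewrite /GRing.scale /= -/m.
  by field.
- move=> x /sub xab; have ? := is_derive_deriv_in ddf xab.
  apply: is_derive_eq; rewrite /GRing.scale /=.
  by rewrite /deriv2_in; ring.
- move=> x; rewrite in_itv /= => /andP[/ltW lx /ltW xr].
  by rewrite subr_le0; apply: admissible_deriv2_le => //; rewrite in_itv /= lx.
- have cf : {within `[lend K, rend K], continuous (coef i)}.
    apply: continuous_subspaceW (derivable_in_continuous df).
    by apply: subset_itvScc; rewrite bnd_simp.
  move=> x; apply: cvgB; first exact: cf.
  have : {within `[lend K, rend K], continuous (fun y : R => alpha K i / 2 * (y - m) ^+ 2)}.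
    apply: continuous_subspaceT => z; apply: cvgM; first exact: cvg_cst.
    have cz : (z0 - m) @[z0 --> z] --> z - m by apply: cvgB; [exact: cvg_id | exact: cvg_cst].
    exact: (cvgM cz cz).
  exact.
Qed.

(** Every [y] lies in some cell, and [x >= 0] lets the coefficientwise bounds there add up to a
    bound for the constraint at [y]. *)
Lemma feasible_R2_feasible (T : seq (cell R n)) :
  is_subdivision a b T -> admissible a b coef T ->
  feasible_R2 coef T `<=` feasible a b coef.
Proof.
move=> sT aT x [x0 Tx]; split=> // y yab.
have [K KT yK] := subdivision_cover sT hab yab.
have [al lr rb] := subdivision_cell sT KT.
have lec i : abar_min coef K i <= coef i y.
  exact: le_trans (abar_min_le i al rb (aT K KT) yK) (abar_le_coef i y (aT K KT)).
apply: le_trans (Tx K KT) _; apply: lerD => //.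
by rewrite /dot mxE; apply: ler_sum => i _; rewrite !mxE ler_wpM2r.
Qed.

(* The endpoints of a child are at distance [w / 6]
   from its midpoint, where [w] is the length of the parent, and this is at most
   their distance to the midpoint of the parent. *)
Lemma abar_min_trisects (K K1 K2 K3 K' : cell R n) i :
  a <= lend K -> lend K <= rend K -> rend K <= b -> admissible_cell a b coef K ->
  trisects a b coef K K1 K2 K3 -> K' \in [:: K1; K2; K3] ->
  abar_min coef K i <= abar_min coef K' i.
Proof.
move=> al lr rb adm tri K'in.
suff [adm' le' [ll' lr'] [rl' rr'] [dl dr]] :
    [/\ admissible_cell a b coef K', alpha K' i <= alpha K i,
      lend K <= lend K' /\ lend K' <= rend K,
      lend K <= rend K' /\ rend K' <= rend K &
      (lend K' - (lend K' + rend K') / 2) ^+ 2 <=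
        (lend K' - (lend K + rend K) / 2) ^+ 2 /\
      (rend K' - (lend K' + rend K') / 2) ^+ 2 <=
        (rend K' - (lend K + rend K) / 2) ^+ 2].
  (* At an endpoint of the child, both the parameter and the squared distance to the midpoint have
     shrunk, so less is subtracted than for the parent. *)
  have abarK y : y \in `[lend K, rend K] ->
      (y - (lend K' + rend K') / 2) ^+ 2 <= (y - (lend K + rend K) / 2) ^+ 2 ->
      abar_min coef K i <= abar coef K' i y.
    move=> yK dy; apply: le_trans (abar_min_le i al rb adm yK) _.
    rewrite /abar lerB // ler_pM ?sqr_ge0 ?divr_ge0 //.
      exact: admissible_alpha_ge0.
    by rewrite ler_wpM2r.
  by rewrite le_min !abarK // in_itv /= ?ll' ?rl'.
have [] := tri; rewrite /child_of; set s := lend K; set t := rend K.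
have : 0 <= t - s by rewrite subr_ge0.
set w := t - s => w0.
have -> : t = s + w by rewrite /w addrC subrK.
(* Once expanded, the squared distances are multiples of [w * w], so their comparison is linear in
   this product. *)
have w20 : 0 <= w * w by rewrite mulr_ge0.
move=> [l1 r1 ad1 al1] [l2 r2 ad2 al2] [l3 r3 ad3 al3].
move: K'in; rewrite !inE => /or3P[] /eqP ->.
- by rewrite l1 r1; split=> //; split; rewrite ?expr2; lra.
- by rewrite l2 r2; split=> //; split; rewrite ?expr2; lra.
- by rewrite l3 r3; split=> //; split; rewrite ?expr2; lra.
Qed.

Lemma refines_mem (T T' : seq (cell R n)) (K' : cell R n) :
  refines a b coef T T' -> K' \in T' ->
  exists2 K, K \in T & K' = K \/
    exists K1 K2 K3, trisects a b coef K K1 K2 K3 /\ K' \in [:: K1; K2; K3].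
Proof.
elim=> // [K {}T {}T' _ IH|K K1 K2 K3 {}T {}T' tri _ IH].
  rewrite in_cons => /orP[/eqP ->|/IH [L LT HL]].
    by exists K; [rewrite mem_head | left].
  by exists L; [rewrite in_cons LT orbT | ].
rewrite -[_ :: _]/([:: K1; K2; K3] ++ T') mem_cat => /orP[K'in|/IH [L LT HL]].
  by exists K; [rewrite mem_head | right; exists K1, K2, K3].
by exists L; [rewrite in_cons LT orbT | ].
Qed.

Lemma feasible_R2_refines (T T' : seq (cell R n)) :
  is_subdivision a b T -> admissible a b coef T -> refines a b coef T T' ->
  feasible_R2 coef T `<=` feasible_R2 coef T'.
Proof.
move=> sT aT ref x [x0 Tx]; split=> // K' /(refines_mem ref) [K KT].
case=> [->|[K1 [K2 [K3 [tri K'in]]]]]; first exact: Tx.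
have [al lr rb] := subdivision_cell sT KT.
have leK i := abar_min_trisects i al lr rb (aT K KT) tri K'in.
by apply: le_trans (Tx K KT) _; apply: lerD => //; apply: ler_sum => i _; rewrite ler_wpM2r.
Qed.

(** Carries a bound on the initial parameters along the whole sequence. *)
Lemma alpha_refines (T T' : seq (cell R n)) i M :
  refines a b coef T T' -> (forall K : cell R n, K \in T -> alpha K i <= M) ->
  forall K : cell R n, K \in T' -> alpha K i <= M.
Proof.
move=> ref HM K' /(refines_mem ref) [K KT].
case=> [->|[K1 [K2 [K3 [[[_ _ _ a1] [_ _ _ a2] [_ _ _ a3]]]]]]]; first exact: HM.
by rewrite !inE => /or3P[] /eqP ->; apply: le_trans (HM K KT).
Qed.

(** The constant is uniform in [k]. Comparing with the left endpoint on every cell lets one point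
    serve all coefficients at once. *)
Lemma abar_min_ge (T : nat -> seq (cell R n)) i :
  (forall k, is_subdivision a b (T k)) -> (forall k, admissible a b coef (T k)) ->
  (forall k, refines a b coef (T k) (T k.+1)) ->
  exists C, forall k (K : cell R n), K \in T k ->
    coef i (lend K) - C * (rend K - lend K) <= abar_min coef K i.
Proof.
move=> sT aT ref; have [L L0 HL] := C2_on_lipschitz (ltW hab) (hC2 i).
pose M := \big[Num.max/0]_(K <- T 0%N) alpha K i.
have HM k : forall K : cell R n, K \in T k -> alpha K i <= M.
  elim: k => [K KT|k IH].
    exact: (@le_bigmax_seq _ _ _ _ 0 K xpredT (fun K => alpha K i)).
  exact: alpha_refines (ref k) IH.
(* [L] pays for moving from the right endpoint to the left one; [M * (b - a)] pays for the quadratic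
   term, one factor of the cell length being bounded by [b - a]. *)
exists (L + M * (b - a)) => k K KT; have [al lr rb] := subdivision_cell (sT k) KT.
have aM := HM k K KT; have a0 := admissible_alpha_ge0 i (aT k K KT).
have := HL _ _ al lr rb; rewrite ler_norml => /andP[lip _].
set w := rend K - lend K in lip *.
have w0 : 0 <= w by rewrite subr_ge0.
have wba : w <= b - a by rewrite /w lerB.
have q : alpha K i / 2 * (w / 2) ^+ 2 <= M * (b - a) * w.
  have : alpha K i * w <= M * (b - a) by rewrite ler_pM.
  move=> /(ler_wpM2r w0); have := mulr_ge0 (mulr_ge0 a0 w0) w0.
  rewrite expr2; lra.
have Lw : 0 <= L * w by rewrite mulr_ge0.
rewrite le_min /abar.
have -> : lend K - (lend K + rend K) / 2 = - (w / 2) by rewrite /w; field.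
have -> : rend K - (lend K + rend K) / 2 = w / 2 by rewrite /w; field.
by rewrite sqrrN mulrDl; apply/andP; split; lra.
Qed.

End Cells.

(** * The inner product and the topology of the feasible set *)

Lemma dotE (R : realType) (n : nat) (u v : 'cV[R]_n) :
  dot u v = \sum_i u i 0 * v i 0.
Proof. by rewrite /dot mxE; apply: eq_bigr => i _; rewrite mxE. Qed.

Lemma dotDr (R : realType) (n : nat) (u v w : 'cV[R]_n) :
  dot u (v + w) = dot u v + dot u w.
Proof. by rewrite /dot mulmxDr mxE. Qed.

Lemma dotZr (R : realType) (n : nat) (l : R) (u v : 'cV[R]_n) :
  dot u (l *: v) = l * dot u v.
Proof. by rewrite /dot -scalemxAr mxE. Qed.

Lemma dot_continuous (R : realType) (n : nat) (u : 'cV[R]_n) :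
  continuous (dot u).
Proof.
move=> x; rewrite (_ : dot u = fun v : 'cV[R]_n => \sum_i u i 0 * v i 0).
  apply: cvg_big; [exact: add_continuous | exact: (nbhs_filter x) | move=> i _].
  by apply: (@cvgM _ _ (nbhs x)); [exact: cvg_cst | exact: coord_continuous].
by apply/funext => v; rewrite dotE.
Qed.

(** The set is an intersection of closed half-spaces. *)
Lemma closed_feasible (R : realType) (n : nat) (a b : R)
    (coef : 'I_n.+1 -> R -> R) : closed (feasible a b coef).
Proof.
rewrite (_ : feasible a b coef =
  (\bigcap_i [set x : 'cV[R]_n | 0 <= x i 0]) `&`
  \bigcap_(y in `[a, b]) [set x : 'cV[R]_n | - coef ord0 y <= dot (avec coef y) x]).
  apply: closedI.
    apply: closed_bigI => i _.
    apply: (@preimage_closed _ _ (fun x : 'cV[R]_n => x i 0) [set r | 0 <= r]).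
      by move=> x _; exact: coord_continuous.
    exact: closed_ge.
  apply: closed_bigI => y _.
  apply: (@preimage_closed _ _ (dot (avec coef y)) [set r | - coef ord0 y <= r]).
    by move=> x _; exact: dot_continuous.
  exact: closed_ge.
apply/seteqP; split=> x [x0 Hx]; split=> [i|y yab].
- by move=> _; exact: x0.
- by rewrite /= -subr_ge0 opprK; exact: Hx.
- exact: x0.
- by have := Hx y yab; rewrite /= -subr_ge0 opprK.
Qed.

Lemma bounded_dot_ge (R : realType) (n : nat) (c : 'cV[R]_n) (S : set 'cV[R]_n) :
  bounded_set S -> exists B, forall x, S x -> B <= dot c x.
Proof.
(* Boundedness supplies a norm bound for each real strictly above [M], hence [M + 1]; the max norm
   dominates every coordinate. *)
move=> [M [_ HM]]; exists (- \sum_i `|c i 0| * (M + 1)) => x Sx.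
rewrite lerNl (le_trans (ler_norm _)) // normrN dotE.
apply: le_trans (ler_norm_sum _ _ _) _; apply: ler_sum => i _.
rewrite normrM ler_wpM2l // (le_trans _ (HM (M + 1) _ x Sx)) ?ltrDl //.
have -> : `|x| = mx_norm x by [].
by rewrite mx_normrE (le_bigmax _ (fun ij : 'I_n * 'I_1 => `|x ij.1 ij.2|) (i, 0)).
Qed.

(** * Slater points and the approximate problems *)

Section Convergence.
Variables (R : realType) (n : nat) (a b : R) (coef : 'I_n.+1 -> R -> R).
Hypotheses (hab : a < b) (hC2 : forall i, C2_on `[a, b] (coef i)).

(** The constraints are affine: the slack is [1 - l] times a nonnegative number plus [l] times a
    positive one. *)
Lemma slater_point_segment (x z : 'cV[R]_n) (l : R) :
  slater_point a b coef x -> feasible a b coef z -> 0 < l -> l <= 1 ->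
  slater_point a b coef (z + l *: (x - z)).
Proof.
move=> [x0 Hx] [z0 Hz] l0 l1; split=> [i|y yab].
  rewrite !mxE; have := mulr_ge0 (ltW l0) (x0 i).
  have : 0 <= (1 - l) * z i 0 by rewrite mulr_ge0 ?subr_ge0 ?z0.
  by rewrite mulrBr mulrBl mul1r; lra.
rewrite dotDr dotZr dotDr -scaleN1r dotZr mulN1r.
have := mulr_gt0 l0 (Hx y yab).
have : 0 <= (1 - l) * (dot (avec coef y) z + coef ord0 y).
  by rewrite mulr_ge0 ?subr_ge0 ?Hz.
by lra.
Qed.

(** The slack is continuous in [y] and attains its minimum on the compact interval. *)
Lemma slater_point_margin (z : 'cV[R]_n) : slater_point a b coef z ->
  exists2 d, 0 < d &
    forall y, y \in `[a, b] -> d <= dot (avec coef y) z + coef ord0 y.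
Proof.
move=> [_ Hz].
have cz : {within `[a, b], continuous (fun y => dot (avec coef y) z + coef ord0 y)}.
  have cc i : {within `[a, b], continuous (coef i)} := C2_on_continuous (hC2 i).
  move=> y; apply: cvgD; last exact: cc.
  rewrite (_ : (fun _ => _) = fun y => \sum_i coef (lift ord0 i) y * z i 0).
    rewrite dotE; under eq_bigr do rewrite mxE.
    apply: cvg_big => [|i _]; first exact: add_continuous.
    by apply: cvgM; [exact: cc | exact: cvg_cst].
  by apply/funext => t; rewrite dotE; apply: eq_bigr => i _; rewrite mxE.
have [y yab Hy] := EVT_min (ltW hab) cz.
by exists (dot (avec coef y) z + coef ord0 y); first exact: Hz.
Qed.

Lemma slater_point_feasible_R2 (T : nat -> seq (cell R n)) (z : 'cV[R]_n) :
  (forall k, is_subdivision a b (T k)) -> (forall k, admissible a b coef (T k)) ->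
  (forall k, refines a b coef (T k) (T k.+1)) -> mesh (T k) @[k --> \oo] --> 0 ->
  slater_point a b coef z -> \forall k \near \oo, feasible_R2 coef (T k) z.
Proof.
move=> sT aT ref mT sz; have [d d0 Hd] := slater_point_margin sz.
have [z0 _] := sz.
have [C HC] := choice (fun i => abar_min_ge hab hC2 i sT aT ref).
(* On a cell of length [w] the total loss in the constraint is at most [S * w]. The sign of [S] is
   unknown, so the mesh is compared with [d / (|S| + 1)]. *)
pose S := \sum_(i < n) C (lift ord0 i) * z i 0 + C ord0.
have S0 : 0 < `|S| + 1 by rewrite ltr_wpDl.
have e0 : 0 < d / (`|S| + 1) by rewrite divr_gt0.
near=> k; split=> // K KT; have [al lr rb] := subdivision_cell (sT k) KT.
have w0 : 0 <= rend K - lend K by rewrite subr_ge0.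
have wS : S * (rend K - lend K) <= d.
  have mk : `|mesh (T k)| < d / (`|S| + 1) by near: k; exact: cvgr0_norm_lt.
  have : rend K - lend K <= d / (`|S| + 1).
    exact: le_trans (mesh_ge KT) (le_trans (ler_norm _) (ltW mk)).
  rewrite ler_pdivlMr // mulrC; apply: le_trans; rewrite ler_wpM2r //.
  by rewrite (le_trans (ler_norm S)) // lerDl.
have lab : lend K \in `[a, b] by rewrite in_itv /= al (le_trans lr).
apply: le_trans (_ : 0 <= d - S * (rend K - lend K)) _; first by rewrite subr_ge0.
apply: le_trans (lerB (Hd _ lab) (lexx _)) _.
rewrite dotE /S mulrDl opprD addrACA; apply: lerD; last exact: HC KT.
rewrite mulr_suml -sumrB; apply: ler_sum => i _; rewrite mxE.
have := ler_wpM2r (z0 i) (HC (lift ord0 i) k K KT); rewrite mulrBl.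
by rewrite (mulrAC (C _)).
Unshelve. all: by end_near. Qed.

End Convergence.

(** * Passing to the limit *)

Lemma le_of_forall_le_segment (R : realType) (v u d : R) :
  (forall l, 0 < l -> l <= 1 -> v <= u + l * d) -> v <= u.
Proof.
move=> H; rewrite leNgt; apply/negP => uv.
have d0 : 0 < d by have := H 1 ltr01 (lexx 1); lra.
(* This [l] makes [l * d] at most half of the supposed gap [v - u]. *)
have : v <= u + Num.min 1 ((v - u) / (2 * d)) * d.
  by apply: H; rewrite ?ge_min ?lexx // lt_min ltr01 divr_gt0 ?subr_gt0 ?mulr_gt0.
have : Num.min 1 ((v - u) / (2 * d)) * d <= (v - u) / 2.
  have -> : (v - u) / 2 = (v - u) / (2 * d) * d by field; rewrite gt_eqF.
  by rewrite ler_wpM2r ?(ltW d0) // ge_min lexx orbT.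
by lra.
Qed.

Theorem theorem3p7 (R : realType) (n : nat) (a b : R) (hab : a < b)
    (c : 'cV[R]_n) (coef : 'I_n.+1 -> R -> R)
    (hC2 : forall i, C2_on `[a, b] (coef i))
    (hslater : slater_condition a b coef)
    (hlevel : exists xbar : 'cV[R]_n,
        slater_point a b coef xbar /\ bounded_set (level_set a b coef c xbar))
    (T : nat -> seq (cell R n))
    (hsub : forall k, is_subdivision a b (T k))
    (hadm : forall k, admissible a b coef (T k))
    (href : forall k, trisection_refinement a b coef (T k) (T k.+1))
    (hcons : consistent coef (T 0%N))
    (hmesh : mesh (T k) @[k --> \oo] --> 0)
    (x : nat -> 'cV[R]_n)
    (hx : forall k, optimal_solution c (feasible_R2 coef (T k)) (x k)) :
  ((forall k, feasible a b coef (x k)) /\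
   (forall z, cluster (x @ \oo) z -> feasible a b coef z)) /\
  ((forall k, dot c (x k.+1) <= dot c (x k)) /\
   exists v : R, dot c (x k) @[k --> \oo] --> v /\
                 v%:E = optimal_value a b coef c).
Proof.
have ref k : refines a b coef (T k) (T k.+1) by have [] := href k.
have xF k : feasible a b coef (x k).
  by apply: (feasible_R2_feasible hab hC2 (hsub k) (hadm k)); have [] := hx k.
have dec k : dot c (x k.+1) <= dot c (x k).
  have [_ ->] // := hx k.+1.
  by apply: (feasible_R2_refines hab hC2 (hsub k) (hadm k) (ref k)); have [] := hx k.
split; split=> //.
  (* A cluster point lies in the closure of every set containing a tail of the sequence. *)
  move=> z; rewrite clusterE => Hz; apply: closed_feasible; apply: Hz.
  by exists 0%N => // k _; exact: xF.
have [xb [sxb bxb]] := hlevel.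
have [B HB] := bounded_dot_ge c bxb.
(* Either [x k] lies in the bounded level set, or its value exceeds that of [xb]. *)
have lb k : Num.min B (dot c xb) <= dot c (x k).
  have [le|/ltW ge] := leP (dot c (x k)) (dot c xb); rewrite ge_min ?ge ?orbT //.
  by rewrite HB.
have cv : cvgn (fun k => dot c (x k)).
  apply: nonincreasing_is_cvgn; first by apply/nonincreasing_seqP.
  by exists (Num.min B (dot c xb)) => _ [k _ <-].
set v := lim _ in cv.
(* Points [z + l *: (xb - z)] are Slater points, eventually feasible for the approximate problems,
   so their values bound the limit from above; then [l] shrinks to zero. *)
have vF z : feasible a b coef z -> v <= dot c z.
  move=> Fz; apply: (@le_of_forall_le_segment _ _ _ (dot c (xb - z))) => l l0 l1.
  have sl := slater_point_segment sxb Fz l0 l1.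
  rewrite -dotZr -dotDr; apply: limr_le => //.
  have := slater_point_feasible_R2 hab hC2 hsub hadm ref hmesh sl.
  by apply: filterS => k; have [_] := hx k; apply.
exists v; split=> //; apply/eqP; rewrite eq_le; apply/andP; split.
  by apply: le_ereal_inf_tmp => _ [z Fz <-]; rewrite lee_fin; exact: vF.
(* For the reverse inequality, some feasible [x N] has value below [v + e]. *)
apply/lee_addgt0Pr => e e0.
have /cvgrPdist_lt /(_ e e0) [N _ /(_ N (leqnn N)) /=] := cv.
rewrite ltr_norml => /andP[vx _].
apply: ge_ereal_inf; exists (dot c (x N))%:E; first by exists (x N).
by rewrite -EFinD lee_fin; lra.
Qed.
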